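(* Let $q=p^f$ with $p$ prime, let $V=\mathbb{F}_{q^2}^3$ be equipped with the Hermitian form $\beta(x,y)=x_1y_3^q+x_2y_2^q+x_3y_1^q$, and let $\Omega$ be the set of totally isotropic one-dimensional subspaces of $V$ (so $|\Omega|=q^3+1$), on which $\mathrm{PGU}(3,q)$ and $\mathrm{PSU}(3,q)$ act as permutation groups. Let $h$ be the permutation of $\Omega$ given by $\langle(x_1,x_2,x_3)\rangle^h=\langle(x_1^p,x_2^p,x_3^p)\rangle$. Then \[ q^3-p\leqslant \mathrm{Cr}_{q^3+1}(\mathrm{PGU}(3,q))\leqslant \mathrm{Cr}_{q^3+1}(\mathrm{PSU}(3,q))\leqslant q^3-\gcd(2,q). \] In particular, if $q$ is even then $\mathrm{Cr}_{q^3+1}(\mathrm{PGU}(3,q))=\mathrm{Cr}_{q^3+1}(\mathrm{PSU}(3,q))=q^3-2$. Moreover, $d_{q^3+1}(h,\mathrm{PGU}(3,q))=q^3-p$.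
   Context: Permutation groups act on the right. For $n\geqslant 2$ and $g,h$ in the symmetric group on an $n$-set, the Hamming distance is $d_n(g,h)=n-|\mathrm{fix}(gh^{-1})|$, where $\mathrm{fix}(x)$ is the set of fixed points of $x$. For a subset $C$ of the symmetric group and a permutation $v$, $d_n(v,C)=\min\{d_n(v,c)\mid c\in C\}$, and the covering radius of $C$ is $\mathrm{Cr}_n(C)=\max\{d_n(v,C)\mid v \text{ a permutation of the }n\text{-set}\}$. Here groups of permutations of $\Omega$ are regarded as subsets of $\mathrm{Sym}(\Omega)$ with $n=q^3+1$. *)

(* Defs.v *)
From HB Require Import structures.
From mathcomp Require Import all_boot all_order all_fingroup all_algebra.
From mathcomp Require Import all_solvable all_field.

Set Implicit Arguments.
Unset Strict Implicit.
Unset Printing Implicit Defensive.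

Import GRing.Theory.
Local Open Scope ring_scope.

Section FinVspace.
Import VectorInternalTheory.
Variables (K : finFieldType) (vT : vectType K).
HB.instance Definition _ := [Countable of {vspace vT} by <:].
HB.instance Definition _ := [Finite of {vspace vT} by <:].
End FinVspace.

Section CoveringRadius.

Variable T : finType.
Implicit Types (g h v : {perm T}) (C : {set {perm T}}).

(* mathcomp permutations compose on the right: (g * h)%g x = h (g x). *)
Definition hamming g h : nat :=
  (#|T| - #|[set x | (g * h^-1)%g x == x]|)%N.

(* Distances never exceed #|T|, so the default #|T| does not affect the minimum
   over a nonempty C. *)
Definition hamming_to v C : nat := \big[minn/#|T|]_(c in C) hamming v c.

Definition covering_radius C : nat :=
  (\max_(v : {perm T}) hamming_to v C)%N.

End CoveringRadius.

Section Unitary.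

Variables (F : finFieldType) (q : nat).
Local Notation V := 'rV[F]_3.

Definition beta (x y : V) : F :=
  x 0 0 * y 0 2 ^+ q + x 0 1 * y 0 1 ^+ q + x 0 2 * y 0 0 ^+ q.

Definition totally_isotropic (U : {vspace V}) : bool :=
  [forall x in U, forall y in U, beta x y == 0].

Definition isotropic_point (U : {vspace V}) : bool :=
  (\dim U == 1)%N && totally_isotropic U.

Definition Omega : finType := {U : {vspace V} | isotropic_point U}.

Definition GU : {set 'M[F]_3} :=
  [set g in unitmx | [forall x, forall y, beta (x *m g) (y *m g) == beta x y]].

Definition SU : {set 'M[F]_3} := [set g in GU | \det g == 1].

Definition induced_perms (G : {set 'M[F]_3}) : {set {perm Omega}} :=
  [set s : {perm Omega} | [exists g in G,
     [forall w : Omega, sval (s w) == (linfun (mulmxr g) @: sval w)%VS]]].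

(* The scalars in GU (resp. SU) are exactly the elements acting trivially on
   Omega, so the projective groups are these groups of induced permutations. *)
Definition PGU : {set {perm Omega}} := induced_perms GU.
Definition PSU : {set {perm Omega}} := induced_perms SU.

Lemma dim1_vline (U : {vspace V}) :
  \dim U = 1%N -> exists2 v, v != 0 & U = <[v]>%VS.
Proof.
move=> dU; exists (vpick U); first by rewrite vpick0 -dimv_eq0 dU.
apply/esym/eqP; rewrite eqEdim -memvE memv_pick dU dim_vline vpick0.
by rewrite -dimv_eq0 dU.
Qed.

Lemma GU_induces (g : 'M[F]_3) : g \in GU ->
  exists s : {perm Omega},
    forall w, sval (s w) = (linfun (mulmxr g) @: sval w)%VS.
Proof.
rewrite inE => /andP [ug /forallP isog].
have injg : injective (linfun (mulmxr g) : 'End(V)).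
  by move=> x y; rewrite !lfunE /=; apply: (can_inj (mulmxK ug)).
have kerg : lker (linfun (mulmxr g) : 'End(V)) == 0%VS by apply/lker0P.
have stab (w : Omega) : isotropic_point (linfun (mulmxr g) @: sval w)%VS.
  case/andP: (svalP w) => /eqP dw /forall_inP iw; apply/andP; split.
    by rewrite limg_dim_eq ?dw // (eqP kerg) capv0.
  apply/forall_inP=> _ /memv_imgP [x xw ->].
  apply/forall_inP=> _ /memv_imgP [y yw ->]; rewrite !lfunE /=.
  by move: (isog x) => /forallP /(_ y) /eqP ->; have /forall_inP := iw x xw; apply.
have inj_act : injective (fun w : Omega => exist isotropic_point _ (stab w) : Omega).
  move=> w1 w2 [] eqw; apply: val_inj.
  by apply/eqP; rewrite -(eq_limg_ker0 _ _ kerg); apply/eqP.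
by exists (perm inj_act) => w; rewrite permE.
Qed.

Section Frobenius.

Variable p : nat.

Definition pow_coords (x : V) : V := map_mx (fun a => a ^+ p) x.

(* The semilinear map pow_coords carries subspaces to subspaces when p is the
   characteristic; the span then adds nothing to the image (frob_vline). *)
Definition frob_vspace (U : {vspace V}) : {vspace V} :=
  <<[seq pow_coords x | x in U]>>%VS.

Hypothesis pcharF : p \in [pchar F].

Lemma powp_inj : injective (fun a : F => a ^+ p).
Proof. exact: (fmorph_inj (pFrobenius_aut pcharF)). Qed.

Lemma pow_coords_inj : injective pow_coords.
Proof.
by move=> x y /matrixP exy; apply/matrixP=> i j; apply: powp_inj;
   have := exy i j; rewrite !mxE.
Qed.

Lemma pow_coordsZ a x : pow_coords (a *: x) = a ^+ p *: pow_coords x.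
Proof. by apply/matrixP=> i j; rewrite !mxE exprMn. Qed.

Lemma pow_coords0 : pow_coords 0 = 0.
Proof.
by apply/matrixP=> i j; rewrite !mxE expr0n (gtn_eqF (prime_gt0 (pcharf_prime pcharF))).
Qed.

Lemma frob_vline (v : V) : frob_vspace <[v]> = <[pow_coords v]>%VS.
Proof.
apply/eqP; rewrite eqEsubv; apply/andP; split.
  apply/span_subvP=> _ /imageP [x /vlineP [a ->] ->].
  by rewrite pow_coordsZ memvZ ?memv_line.
by rewrite -memvE memv_span //; apply/imageP; exists v; rewrite ?memv_line.
Qed.

Lemma beta_pow_coords x y : beta (pow_coords x) (pow_coords y) = beta x y ^+ p.
Proof.
rewrite /beta !mxE -![_ ^+ p ^+ q]exprAC -!exprMn.
by rewrite -!(pFrobenius_autE pcharF) -!rmorphD.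
Qed.

Lemma frob_Omega (w : Omega) : isotropic_point (frob_vspace (sval w)).
Proof.
case/andP: (svalP w) => /eqP /dim1_vline [v nzv ->] /forall_inP iw.
rewrite /isotropic_point frob_vline dim_vline -{1}pow_coords0 (inj_eq pow_coords_inj) nzv /=.
have /forall_inP/(_ _ (memv_line v))/eqP bv0 := iw v (memv_line v).
apply/forall_inP=> _ /vlineP [a ->]; apply/forall_inP=> _ /vlineP [b ->].
have -> : beta (a *: pow_coords v) (b *: pow_coords v) =
          a * b ^+ q * beta (pow_coords v) (pow_coords v).
  rewrite /beta !mxE !exprMn !mulrDr.
  by congr (_ + _ + _); rewrite mulrACA.
by rewrite beta_pow_coords bv0 -(pFrobenius_autE pcharF) rmorph0 mulr0.
Qed.

Definition frob_fun (w : Omega) : Omega := exist isotropic_point _ (frob_Omega w).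

Lemma frob_fun_inj : injective frob_fun.
Proof.
move=> w1 w2 [] eqw; apply: val_inj => /=; move: eqw.
case/andP: (svalP w1) => /eqP /dim1_vline [v1 nz1 ->] _.
case/andP: (svalP w2) => /eqP /dim1_vline [v2 nz2 ->] _.
rewrite !frob_vline => eqv.
have /vlineP [a ea] : pow_coords v1 \in <[pow_coords v2]>%VS.
  by rewrite -eqv memv_line.
have [frobV _ frobVK] := injF_bij powp_inj.
have ev : v1 = frobV a *: v2.
  by apply: pow_coords_inj; rewrite pow_coordsZ frobVK.
apply/eqP; rewrite eqEdim !dim_vline nz1 nz2 leqnn andbT -memvE ev.
by rewrite memvZ ?memv_line.
Qed.

Definition frob_perm : {perm Omega} := perm frob_fun_inj.

Lemma frob_permE (w : Omega) (v : V) :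
  sval w = <[v]>%VS -> sval (frob_perm w) = <[pow_coords v]>%VS.
Proof. by move=> ew; rewrite permE /= ew frob_vline. Qed.

End Frobenius.

Lemma pchar_of_card (p f : nat) :
  prime p -> q = (p ^ f)%N -> #|F| = (q ^ 2)%N -> p \in [pchar F].
Proof.
move=> p_pr -> cF; apply: (@card_finPcharP F p (f * 2)) => //.
by rewrite cF expnM.
Qed.

End Unitary.

(* Main.v *)
(**
The root group Q = {u(s,t)} of SU(3,q) fixes <(1,0,0)> and is regular on the other
q^3 points <(s,t,1)>, s + s^q + t^(q+1) = 0; this gives two-transitivity and hence
an element of PSU(3,q) agreeing with any given permutation v in two points.  Suppose
that none agrees in three.  Summing over Q, every element that agrees with v
somewhere does so in exactly two points, so all agreement numbers are even; but if v
moves <(1,0,0)>, as may be arranged by translation, the agreement numbers over Q add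
up to q^3 - 1, which forces q to be odd.

The Frobenius map h agrees with 1 in the p + 1 points with coordinates in F_p.
If g in PGU(3,q) agrees with h in two points, then these may be moved to <(1,0,0)>
and <(0,0,1)>, so that g = diag(a,b,c), and the other agreements are the solutions
of s^p = (a/c) s, t^p = (b/c) t on the unital, of which there are at most p.
*)

Require Import Defs.
From mathcomp Require Import all_boot all_order all_fingroup all_algebra.
From mathcomp Require Import all_solvable all_field ring zify.

Set Implicit Arguments.
Unset Strict Implicit.
Unset Printing Implicit Defensive.

Import GRing.Theory.

(** * Hamming distance through agreement sets *)

Section Agreement.

Variable T : finType.
Implicit Types (g h k u v : {perm T}) (C D : {set {perm T}}).

Definition agreement v g : {set T} := [set x | g x == v x].

Lemma in_agreement v g x : (x \in agreement v g) = (g x == v x).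
Proof. by rewrite inE. Qed.

Lemma hammingE v g : hamming v g = #|T| - #|agreement v g|.
Proof.
congr (_ - _); apply: eq_card => x; rewrite !inE permM.
by rewrite (canF_eq (permKV g)) eq_sym.
Qed.

Lemma hamming_to_le v C c : c \in C -> hamming_to v C <= hamming v c.
Proof.
rewrite /hamming_to; have: c \in index_enum {perm T} by rewrite mem_index_enum.
elim: (index_enum _) => // d r IHr; rewrite inE big_cons => /orP[/eqP <-|cr] Cc.
  by rewrite Cc geq_minl.
by case: ifP => _; rewrite ?geq_min IHr ?orbT.
Qed.

(** The bound [m <= #|T|] takes care of the default value of the minimum. *)
Lemma leq_hamming_to v C m :
  m <= #|T| -> (forall c, c \in C -> m <= hamming v c) -> m <= hamming_to v C.
Proof.
move=> mT mC; rewrite /hamming_to; elim/big_ind: _ => // a b ma mb.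
by rewrite leq_min ma.
Qed.

Lemma leq_covering_radius v C : hamming_to v C <= covering_radius C.
Proof. exact: (leq_bigmax v). Qed.

Lemma covering_radius_leP C m :
  reflect (forall v, hamming_to v C <= m) (covering_radius C <= m).
Proof.
by apply: (iffP (bigmax_leqP _ _ _)) => H v; [apply: H | move=> _; apply: H].
Qed.

(** Enlarging the set can only lower each distance; applied to PSU(3,q) inside PGU(3,q), this is the
    middle inequality. *)
Lemma covering_radius_subset C D :
  C \subset D -> covering_radius D <= covering_radius C.
Proof.
move=> sCD; apply/covering_radius_leP => v.
apply: leq_trans (leq_covering_radius v C); apply: leq_hamming_to.
  apply: (big_ind (fun m => m <= #|T|)) => // [a b aT _|c _].
    by rewrite geq_min aT.
  by rewrite /hamming leq_subr.
by move=> c Cc; apply: hamming_to_le; apply: (subsetP sCD).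
Qed.

Lemma hamming_to_leq_agreement v C g m :
  g \in C -> m <= #|agreement v g| -> hamming_to v C <= #|T| - m.
Proof.
by move=> Cg mg; apply: leq_trans (hamming_to_le v Cg) _;
   rewrite hammingE leq_sub2l.
Qed.

(** * Groups with a subset fixing one point and regular on the others *)

Section RegularStabilizer.

(** In the application [G] is PSU(3,q), [Q] its root group and [a0] the point <(1,0,0)>. *)
Variables (G : {group {perm T}}) (Q : {set {perm T}}) (a0 : T).
Hypothesis QG : Q \subset G.
Hypothesis Q1 : 1%g \in Q.
Hypothesis Qfix : forall g, g \in Q -> g a0 = a0.
Hypothesis Qtrans : forall b c, b != a0 -> c != a0 ->
  exists2 g, g \in Q & g b = c.
Hypothesis Qfree : forall b g h, b != a0 -> g \in Q -> h \in Q ->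
  g b = h b -> g = h.
Hypothesis Gmoves : exists2 s, s \in G & s a0 != a0.

Lemma transitive_of_regular b : exists2 g, g \in G & g a0 = b.
Proof.
have [->|nb] := eqVneq b a0; first by exists 1%g; rewrite ?group1 ?perm1.
have [s Gs ns] := Gmoves; have [g Qg gE] := Qtrans ns nb.
by exists (s * g)%g; rewrite ?permM // groupM // (subsetP QG).
Qed.

(** A first element takes [a0] to [b]; precomposing with an element of [Q], which fixes [a0], then
    corrects the image of [d]. *)
Lemma two_transitive_of_regular b c d : d != a0 -> b != c ->
  exists g, [/\ g \in G, g a0 = b & g d = c].
Proof.
move=> nd nbc; have [k Gk kE] := transitive_of_regular b.
have nkc : (k^-1)%g c != a0.
  by rewrite -(inj_eq (@perm_inj _ k)) permKV kE eq_sym.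
have [h Qh hE] := Qtrans nd nkc.
exists (h * k)%g; split; first by rewrite groupM // (subsetP QG).
  by rewrite permM Qfix.
by rewrite permM hE permKV.
Qed.

(* Agreeing points are counted by the unique element of [Q] taking x to u x. *)
Lemma sum_agreement_regular u :
  \sum_(h in Q) #|agreement u h :\ a0| = #|[set x | (x != a0) && (u x != a0)]|.
Proof.
transitivity (\sum_(h in Q) \sum_(x | (x != a0) && (u x != a0)) (h x == u x)).
  apply: eq_bigr => h Qh; rewrite -sum1_card big_mkcond /= [RHS]big_mkcond /=.
  apply: eq_bigr => x _; rewrite !inE; case: (x =P a0) => //= /eqP nx.
  case: (h x =P u x) => [<-|_] /=; last by case: ifP.
  by rewrite -[X in _ == X](Qfix Qh) (inj_eq perm_inj) nx.
rewrite exchange_big /= -sum1_card; apply: eq_big => [x|x /andP[nx nux]].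
  by rewrite inE.
have [g Qg gE] := Qtrans nx nux.
rewrite (bigD1 g) //= gE eqxx big1 // => h /andP[Qh nh].
case: eqP => // hE; case/eqP: nh; apply: Qfree nx Qh Qg _.
by rewrite hE.
Qed.

(** Evaluation at a point other than [a0] is a bijection from [Q] onto the complement of [a0]. *)
Lemma card_regular : 1 < #|T| -> #|Q| = #|T|.-1.
Proof.
case/card_gt1P=> x [y [_ _ nxy]].
have [b nb] : exists b, b != a0.
  have [xa|] := eqVneq x a0; last by exists x.
  by exists y; rewrite -xa eq_sym.
rewrite -(cardsC1 a0) -(card_in_imset (f := fun g : {perm T} => g b)) => [|g h Qg Qh].
  apply: eq_card => c; rewrite !inE; apply/imsetP/idP => [[g Qg ->]|nc].
    by rewrite -[X in _ == X](Qfix Qg) (inj_eq perm_inj).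
  by have [g Qg <-] := Qtrans nb nc; exists g.
exact: Qfree.
Qed.

(** The permutation [k] maps one agreement set onto the other. With [agreement_mulr], agreement
    numbers become invariant under translation on both sides, so points can be normalised. *)
Lemma agreement_moved u k g :
  #|agreement (k * u)%g (k * g)%g| = #|agreement u g|.
Proof.
rewrite -(card_imset _ (@perm_inj _ k)); apply: eq_card => x.
rewrite -(permKV k x) (mem_imset _ _ (@perm_inj _ k)).
by rewrite !inE !permM permKV.
Qed.

Lemma agreement_mulr u g k : agreement (u * k)%g (g * k)%g = agreement u g.
Proof. by apply/setP => x; rewrite !inE !permM (inj_eq perm_inj). Qed.

(** Off [a0] the agreement numbers over [Q] are at most 1 and add up to #|T| - 1 = #|Q|, so each
    equals 1, in particular at the identity; [a0] itself is the second point. *)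
Lemma agreement_regular_fix u : 1 < #|T| -> u a0 = a0 ->
  (forall h, h \in Q -> #|agreement u h| <= 2) -> #|agreement u 1| = 2.
Proof.
move=> T1 ua le2.
have memE h : h \in Q -> #|agreement u h| = #|agreement u h :\ a0|.+1.
  by move=> Qh; rewrite (cardsD1 a0) inE ua Qfix ?eqxx.
have le1 h : h \in Q -> #|agreement u h :\ a0| <= 1.
  by move=> Qh; rewrite -ltnS -memE ?le2.
have sumE : \sum_(h in Q) #|agreement u h :\ a0| = \sum_(h in Q) 1.
  rewrite sum_agreement_regular sum1_card card_regular // -(cardsC1 a0).
  apply: eq_card => x; rewrite !inE.
  have -> : (u x == a0) = (x == a0) by rewrite -{1}ua (inj_eq perm_inj).
  by case: (x == a0).
rewrite memE //; congr _.+1; apply/eqP; rewrite eqn_leq le1 //= lt0n.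
apply/eqP => z; move: sumE; rewrite (bigD1 1%g) //= z (bigD1 1%g (F := fun=> 1)) //=.
have: \sum_(h in Q | h != 1%g) #|agreement u h :\ a0| <= \sum_(h in Q | h != 1%g) 1.
  by apply: leq_sum => h /andP[Qh _]; apply: le1.
by move=> le sE; move: le; rewrite -[leqLHS]add0n sE ltnn.
Qed.

(** Two-transitivity matches the values of [v] at [a0] and at one further point. *)
Lemma exists_agreement_ge2 v : 1 < #|T| ->
  exists2 g, g \in G & 2 <= #|agreement v g|.
Proof.
case/card_gt1P=> x [y [_ _ nxy]].
have [b nb] : exists b, b != a0.
  have [xa|] := eqVneq x a0; last by exists x.
  by exists y; rewrite -xa eq_sym.
have nv : v a0 != v b by rewrite (inj_eq perm_inj) eq_sym.
have [g [Gg g0 gb]] := two_transitive_of_regular nb nv.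
exists g => //; apply/card_gt1P; exists a0, b.
by rewrite !inE g0 gb !eqxx eq_sym.
Qed.

(* If no element agreed with [v] in three points, then each would agree in 0 or
   2 points; but a translate of [v] that moves [a0] agrees with the elements of
   [Q] in #|T| - 2 points altogether. *)
Lemma exists_agreement_ge3 v : 1 < #|T| -> odd #|T| ->
  exists2 g, g \in G & 3 <= #|agreement v g|.
Proof.
move=> T1 oddT; apply/exists_inP.
case: (boolP [exists g in G, 3 <= #|agreement v g|]) => //.
rewrite negb_exists_in => /forall_inP noG.
have le2 g : g \in G -> #|agreement v g| <= 2 by move=> /noG; rewrite -leqNgt.
have even g : g \in G -> ~~ odd #|agreement v g|.
  move=> Gg; have [->|[a]] := set_0Vmem (agreement v g); first by rewrite cards0.
  rewrite inE => /eqP ga; have [k Gk kE] := transitive_of_regular a.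
  suff -> : #|agreement v g| = 2 by [].
  (* Translating on both sides turns [g] into 1 and the common point [a] into [a0], so that
     [agreement_regular_fix] applies. *)
  have <- : #|agreement (k * v * g^-1 * k^-1) 1| = #|agreement v g|.
    rewrite -[RHS](agreement_moved v k) -(agreement_mulr (k * v)%g _ g^-1%g).
    by rewrite -(agreement_mulr (k * v * g^-1)%g _ k^-1%g) mulgK mulgV.
  apply: agreement_regular_fix => //.
    by rewrite !permM kE -ga permK -kE permK.
  (* Undoing the translation compares [v] with [k^-1 * h * k * g], an element of [G], to which the
     bound 2 applies. *)
  move=> h Qh; rewrite -(agreement_mulr _ _ k) mulgKV -(agreement_mulr _ _ g) mulgKV.
  rewrite -(agreement_moved _ k^-1) mulKg; apply: le2.
  by rewrite !groupM ?groupV // (subsetP QG).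
have [s Gs nua] : exists2 s, s \in G & (v * s)%g a0 != a0.
  have [va|nva] := eqVneq (v a0) a0.
    by have [s Gs ns] := Gmoves; exists s; rewrite // permM va.
  by exists 1%g; rewrite ?mulg1 // group1.
have sumE : \sum_(h in Q) #|agreement (v * s) h| =
    #|[set x | (x != a0) && ((v * s)%g x != a0)]|.
  rewrite -sum_agreement_regular; apply: eq_bigr => h Qh.
  by rewrite [LHS](cardsD1 a0) inE Qfix // eq_sym (negbTE nua).
have: ~~ odd (\sum_(h in Q) #|agreement (v * s) h|).
  elim/big_ind: _ => // [m n|h Qh]; first by rewrite oddD => /negbTE-> /negbTE->.
  rewrite -(agreement_mulr _ _ s^-1) mulgK even // groupM ?groupV //.
  exact: (subsetP QG).
(* The points left out are [a0] and its preimage [b] under [u]. They differ because [u] moves [a0],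
   so #|T| - 2 points remain, an odd number. *)
rewrite sumE; set u := (v * s)%g in nua *; set b := (u^-1)%g a0.
have nba : a0 != b by rewrite -(inj_eq (@perm_inj _ u)) permKV.
have -> : [set x | (x != a0) && (u x != a0)] = ~: [set a0; b].
  by apply/setP => x; rewrite !inE negb_or -(canF_eq (permK u)).
by have := cardsC [set a0; b]; rewrite cards2 nba; lia.
Qed.

End RegularStabilizer.

End Agreement.

(** * Conjugation on the field of order q^2 *)

Section Unital.

Variables (p f q : nat) (F : finFieldType).
Hypotheses (p_pr : prime p) (f_gt0 : 0 < f) (q_def : q = p ^ f).
Hypothesis card_F : #|F| = q ^ 2.

Local Open Scope ring_scope.
Local Notation V := 'rV[F]_3.
Local Notation Om := (Omega F q).

Let pcharF : p \in [pchar F] := pchar_of_card p_pr q_def card_F.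

(** The involution over the subfield of order q, with respect to which [beta] is sesquilinear. *)
Definition qconj (a : F) : F := a ^+ q.

Lemma q_pchar_nat : [pchar F].-nat q.
Proof. by rewrite q_def pnatX pnatE ?pcharF. Qed.

Lemma qconjD a b : qconj (a + b) = qconj a + qconj b.
Proof. exact: exprDn_pchar q_pchar_nat. Qed.

Lemma qconjN a : qconj (- a) = - qconj a.
Proof. exact: exprNn_pchar q_pchar_nat. Qed.

Lemma qconjM a b : qconj (a * b) = qconj a * qconj b.
Proof. exact: exprMn. Qed.

Lemma qconj1 : qconj 1 = 1.
Proof. exact: expr1n. Qed.

Lemma q_gt1 : (1 < q)%N.
Proof. by rewrite q_def -(exp1n f) ltn_exp2r ?prime_gt1. Qed.

Lemma qconj0 : qconj 0 = 0.
Proof. by rewrite /qconj expr0n -[q]prednK ?(ltnW q_gt1). Qed.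

Lemma qconjK a : qconj (qconj a) = a.
Proof. by rewrite /qconj -exprM -[RHS]expf_card card_F expnS expn1. Qed.

Lemma qconj_eq0 a : (qconj a == 0) = (a == 0).
Proof. by rewrite /qconj expf_eq0 (ltnW q_gt1). Qed.

Definition qconjE := (qconjD, qconjN, qconjM, qconj0, qconj1, qconjK).

Lemma qconj_prime_field a : a ^+ p = a -> qconj a = a.
Proof.
move=> ap; rewrite /qconj q_def.
by elim: f => [|n IHn]; rewrite ?expr1 // expnSr exprM IHn.
Qed.

(** * Coordinates for vectors and 3 by 3 matrices *)

Definition vec3 (a b c : F) : V := \row_(j < 3) nth 0 [:: a; b; c] j.

Arguments vec3 (a b c)%_ring_scope.

Lemma vec3E a b c :
  (vec3 a b c 0 0 = a) * (vec3 a b c 0 1 = b) * (vec3 a b c 0 2 = c).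
Proof. by rewrite !mxE. Qed.

Lemma vec3_eta (x : V) : x = vec3 (x 0 0) (x 0 1) (x 0 2).
Proof.
apply/rowP => j; rewrite mxE; case: j => [[|[|[|//]]]] j3 /=; congr (x _ _);
  exact: val_inj.
Qed.

Lemma vec3_inj a b c a' b' c' :
  vec3 a b c = vec3 a' b' c' -> [/\ a = a', b = b' & c = c'].
Proof.
move=> e; split.
- by have := congr1 (fun x : V => x 0 0) e; rewrite /= !vec3E.
- by have := congr1 (fun x : V => x 0 1) e; rewrite /= !vec3E.
- by have := congr1 (fun x : V => x 0 2) e; rewrite /= !vec3E.
Qed.

Lemma vec3_eq0 a b c : (vec3 a b c == 0) = [&& a == 0, b == 0 & c == 0].
Proof.
have e0 : 0 = vec3 0 0 0 by rewrite [LHS]vec3_eta !mxE.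
apply/eqP/and3P => [|[/eqP-> /eqP-> /eqP->] //].
by rewrite e0 => /vec3_inj[-> -> ->].
Qed.

Lemma scale_vec3 k a b c : k *: vec3 a b c = vec3 (k * a) (k * b) (k * c).
Proof. by rewrite [LHS]vec3_eta !mxE. Qed.

Lemma betaE a b c a' b' c' : beta q (vec3 a b c) (vec3 a' b' c') =
  a * qconj c' + b * qconj b' + c * qconj a'.
Proof. by rewrite /beta !vec3E. Qed.

Lemma pow_vec3 a b c : pow_coords p (vec3 a b c) = vec3 (a ^+ p) (b ^+ p) (c ^+ p).
Proof. by rewrite [LHS]vec3_eta !mxE. Qed.

Definition mx3 (r0 r1 r2 : V) : 'M[F]_3 := \matrix_(i < 3) nth 0 [:: r0; r1; r2] i.

Lemma mul_vec3_mx a b c (M : 'M[F]_3) :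
  vec3 a b c *m M = a *: row 0 M + b *: row 1 M + c *: row 2 M.
Proof.
apply/rowP => j; rewrite !mxE !big_ord_recl big_ord0 addr0 !mxE /= addrA.
by congr (_ + _ * M _ _ + _ * M _ _); apply: val_inj.
Qed.

Lemma row_mx3 r0 r1 r2 :
  (row 0 (mx3 r0 r1 r2) = r0) * (row 1 (mx3 r0 r1 r2) = r1)
  * (row 2 (mx3 r0 r1 r2) = r2).
Proof. by rewrite !rowK. Qed.

Lemma add_vec3 a b c a' b' c' :
  vec3 a b c + vec3 a' b' c' = vec3 (a + a') (b + b') (c + c').
Proof. by rewrite [LHS]vec3_eta !mxE. Qed.

Definition mul_vec3E := (mul_vec3_mx, row_mx3, scale_vec3, add_vec3).

Lemma det_mx3 (M : 'M[F]_3) : \det M =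
  M 0 0 * (M 1 1 * M 2 2 - M 1 2 * M 2 1) - M 0 1 * (M 1 0 * M 2 2 - M 1 2 * M 2 0)
  + M 0 2 * (M 1 0 * M 2 1 - M 1 1 * M 2 0).
Proof.
rewrite (expand_det_row _ 0) !big_ord_recl big_ord0 /cofactor.
rewrite !(expand_det_row _ ord0) !big_ord_recl !big_ord0 /cofactor !det_mx11 !mxE /=.
(* Indexing the entries by natural numbers lets the index shifts of the cofactors compute. *)
have [g gE] : exists g : nat -> nat -> F, forall i j, M i j = g i j.
  by exists (fun a b => M (inord a) (inord b)) => i j; rewrite !inord_val.
rewrite !gE /= /bump /= !addn0 !add0n !(modn_small (m := 1)) // !addn1.
rewrite !(modn_small (m := 2)) // !expr0 !expr1 expr2; ring.
Qed.

(** * Root elements and an involution in SU(3,q) *)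

Definition umx (s t : F) : 'M[F]_3 :=
  mx3 (vec3 1 0 0) (vec3 (- qconj t) 1 0) (vec3 s t 1).

Definition on_unital (st : F * F) : bool :=
  st.1 + qconj st.1 + st.2 * qconj st.2 == 0.

(** It interchanges <(1,0,0)> and <(0,0,1)>; the sign in the middle makes the determinant 1. *)
Definition wmx : 'M[F]_3 := mx3 (vec3 0 0 1) (vec3 0 (- 1) 0) (vec3 1 0 0).

Lemma mx3E r0 r1 r2 i : (mx3 r0 r1 r2 0 i = r0 0 i) * (mx3 r0 r1 r2 1 i = r1 0 i)
  * (mx3 r0 r1 r2 2 i = r2 0 i).
Proof. by rewrite !mxE. Qed.

Lemma SUP (M : 'M[F]_3) : \det M = 1 ->
  (forall a b c a' b' c', beta q (vec3 a b c *m M) (vec3 a' b' c' *m M) =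
    beta q (vec3 a b c) (vec3 a' b' c')) -> M \in SU F q.
Proof.
move=> d1 isoM; rewrite !inE d1 eqxx andbT unitmxE d1 unitr1 /=.
by apply/forallP => x; apply/forallP => y; rewrite [x]vec3_eta [y]vec3_eta isoM.
Qed.

(** The entry [- qconj t] makes the last two rows orthogonal, and [on_unital] says that the last row
    is isotropic. *)
Lemma umx_SU s t : on_unital (s, t) -> umx s t \in SU F q.
Proof.
rewrite /on_unital /= => /eqP st; apply: SUP.
  by rewrite det_mx3 !mx3E !vec3E; ring.
move=> a b c a' b' c'; rewrite !mul_vec3E !betaE !qconjE.
have -> : qconj s = - (s + t * qconj t) by apply/eqP; rewrite -addr_eq0 addrC addrAC st.
ring.
Qed.

Lemma wmx_SU : wmx \in SU F q.
Proof.
apply: SUP; first by rewrite det_mx3 !mx3E !vec3E; ring.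
by move=> a b c a' b' c'; rewrite !mul_vec3E !betaE !qconjE; ring.
Qed.

(** * Counting the solutions of the unital equation *)

Lemma card_trinomial_roots n (a c : F) : (1 < n)%N ->
  (#|[set x : F | x ^+ n + a * x == c]%R| <= n)%N.
Proof.
move=> n1; pose P : {poly F} := 'X^n + (a *: 'X - c%:P).
have sP : size P = n.+1.
  rewrite size_polyDl size_polyXn // ltnS (leq_trans (size_polyD _ _)) // size_polyN.
  rewrite geq_max (leq_trans (size_scale_leq _ _)) ?size_polyX //.
  by rewrite (leq_trans (size_polyC_leq1 _)) // ltnW.
have Pnz : P != 0 by rewrite -size_poly_eq0 sP.
rewrite -ltnS -sP cardE; apply: max_poly_roots => //; last exact: enum_uniq.
apply/allP => x; rewrite mem_enum inE => /eqP xE.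
by rewrite /root !(hornerD, hornerN, hornerZ, hornerXn, hornerX, hornerC) addrA xE subrr.
Qed.

(* The trace maps F to the at most q fixed points of qconj, with fibres of size at
   most q; as #|F| = q ^ 2, all these bounds are attained. *)
Lemma card_trace_fibre c : qconj c = c -> #|[set x | x + qconj x == c]| = q.
Proof.
move=> cc; pose A := [set d : F | qconj d == d].
have leA : (#|A| <= q)%N.
  rewrite (leq_trans _ (card_trinomial_roots (-1) 0 q_gt1)) // subset_leq_card //.
  by apply/subsetP => d; rewrite !inE mulN1r subr_eq0.
have leq_fib d : (#|[set x | x + qconj x == d]%R| <= q)%N.
  rewrite (leq_trans _ (card_trinomial_roots 1 d q_gt1)) // subset_leq_card //.
  by apply/subsetP => x; rewrite !inE mul1r addrC.
have sumF : (\sum_(d in A) #|[set x | (x + qconj x == d)%R]| = q ^ 2)%N.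
  rewrite -card_F -sum1_card [RHS](partition_big (fun x : F => x + qconj x) (mem A)) /=.
    by apply: eq_bigr => d _; rewrite -sum1_card; apply: eq_bigl => x; rewrite inE.
  by move=> x _; rewrite inE !qconjE addrC.
have cA : c \in A by rewrite inE cc.
apply/eqP; rewrite eqn_leq leq_fib leqNgt; apply/negP => lt_c.
have le_rest : (\sum_(d in A | d != c) #|[set x | (x + qconj x == d)%R]|
    <= #|A|.-1 * q)%N.
  rewrite (leq_trans (leq_sum _ (fun d _ => leq_fib d))) //.
  by rewrite sum_nat_const leq_mul2r (cardD1x cA) leqnn orbT.
move: sumF; rewrite (bigD1 c) //= => sumF.
have : (q ^ 2 < q + #|A|.-1 * q)%N by rewrite -sumF -addSn leq_add.
rewrite -mulSn prednK; last by apply/card_gt0P; exists c.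
by rewrite expnS expn1 ltn_mul2r (ltnNge q) leA andbF.
Qed.

(** For each of the q^2 values of t, the coordinate s runs through the trace fibre over
    [- (t * qconj t)], an element fixed by [qconj]. *)
Lemma card_on_unital : #|[set st : F * F | on_unital st]| = (q ^ 3)%N.
Proof.
rewrite -sum1_card (partition_big (fun st : F * F => st.2) xpredT) //=.
rewrite (eq_bigr (fun=> q)) => [|t _]; first by rewrite sum_nat_const card_F; lia.
rewrite sum1dep_card -(@card_trace_fibre (- (t * qconj t))); last first.
  by rewrite !qconjE mulrC.
rewrite -(card_imset _ (f := fun s : F => (s, t))); last by move=> x y [].
apply: eq_card => -[s t']; rewrite !inE /on_unital /=.
apply/andP/imsetP => [[st /eqP tE]|[x]]; last first.
  by rewrite inE => xE [-> ->]; rewrite eqxx -addr_eq0 in xE *.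
by rewrite tE in st *; exists s => //; rewrite inE -addr_eq0.
Qed.

(** * The points of Omega *)

Lemma isotropic_vline (v : V) : v != 0 -> beta q v v = 0 -> isotropic_point q <[v]>%VS.
Proof.
move=> nv bv; rewrite /isotropic_point dim_vline nv /=.
apply/forall_inP => _ /vlineP[a ->]; apply/forall_inP => _ /vlineP[b ->].
move: bv; rewrite [v]vec3_eta !scale_vec3 !betaE !qconjM => bv.
by apply/eqP; rewrite -[RHS](mulr0 (a * qconj b)) -bv; ring.
Qed.

Lemma pinf_isotropic : isotropic_point q <[vec3 1 0 0]>%VS.
Proof.
apply: isotropic_vline; first by rewrite vec3_eq0 oner_eq0.
by rewrite betaE !qconjE !(mulr0, mul0r, addr0).
Qed.

Lemma paff_isotropic (st : {st | on_unital st}) :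
  isotropic_point q <[vec3 (sval st).1 (sval st).2 1]>%VS.
Proof.
apply: isotropic_vline; first by rewrite vec3_eq0 oner_eq0 !andbF.
by rewrite betaE qconj1 mulr1 mul1r addrAC; apply/eqP/(svalP st).
Qed.

Definition pinf : Om := exist (isotropic_point q) _ pinf_isotropic.
Definition paff (st : {st | on_unital st}) : Om :=
  exist (isotropic_point q) _ (paff_isotropic st).

Lemma vline_eqP (u v : V) : u != 0 ->
  <[u]>%VS = <[v]>%VS -> exists2 k, k != 0 & u = k *: v.
Proof.
move=> nu uv; have /vlineP[k uE] : u \in <[v]>%VS by rewrite -uv memv_line.
by exists k => //; apply: contraNneq nu => k0; rewrite uE k0 scale0r.
Qed.

Lemma vlineZ k (v : V) : k != 0 -> <[(k *: v)%R]>%VS = <[v]>%VS.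
Proof.
move=> nk; apply/eqP; rewrite eqEsubv -!memvE memvZ ?memv_line //=.
by rewrite -{1}[v](scalerK nk) memvZ ?memv_line.
Qed.

Lemma paff_inj : injective paff.
Proof.
move=> st st' /(congr1 val) /= /vline_eqP[|k _].
  by rewrite vec3_eq0 oner_eq0 !andbF.
rewrite scale_vec3 => /vec3_inj[e1 e2]; rewrite mulr1 => k1.
apply: val_inj; move: e1 e2; rewrite -k1 !mul1r => /= e1 e2.
by case: (sval st) (sval st') e1 e2 => [? ?] [? ?] /= -> ->.
Qed.

Lemma paff_neq_pinf st : paff st != pinf.
Proof.
apply/eqP => /(congr1 val) /= /vline_eqP[|k _].
  by rewrite vec3_eq0 oner_eq0 !andbF.
by rewrite scale_vec3 => /vec3_inj[_ _ /eqP]; rewrite mulr0 oner_eq0.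
Qed.

(** If the last coordinate of a generator is 0, isotropy reduces to [b * qconj b = 0] and leaves
    only <(1,0,0)>; otherwise the generator is divided by that coordinate. *)
Lemma OmegaP (w : Om) : w = pinf \/ exists st, w = paff st.
Proof.
case/andP: (svalP w) => /eqP/dim1_vline[v nv wE] /forall_inP.
rewrite wE => /(_ v (memv_line _)) /forall_inP /(_ v (memv_line _)) /eqP.
move: nv wE; rewrite [v]vec3_eta; move: (v 0 0) (v 0 1) (v 0 2) => a b c.
have [->|nc] := eqVneq c 0; rewrite betaE ?qconj0 => nv wE.
  rewrite mulr0 mul0r add0r addr0 => /eqP; rewrite mulf_eq0 qconj_eq0 orbb => /eqP b0.
  move: nv wE; rewrite b0 vec3_eq0 eqxx !andbT => na wE.
  left; apply: val_inj; rewrite /= wE -(vlineZ (vec3 1 0 0) na).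
  by rewrite scale_vec3 mulr1 mulr0.
move=> bv; right.
have st : on_unital (a / c, b / c).
  have ncc : qconj c != 0 by rewrite qconj_eq0.
  have VE : qconj c^-1 = (qconj c)^-1.
    by apply: (mulfI ncc); rewrite -qconjM divff // divff // qconj1.
  rewrite /on_unital /= !qconjM VE.
  apply/eqP; transitivity ((a * qconj c + b * qconj b + c * qconj a) / (c * qconj c)).
    by field; rewrite ncc nc.
  by rewrite bv mul0r.
exists (exist on_unital _ st); apply: val_inj; rewrite /= wE -(vlineZ _ nc).
by rewrite scale_vec3 mulr1 !(mulrC c) !divfK.
Qed.

Lemma card_Omega : #|Om| = (q ^ 3 + 1)%N.
Proof.
have -> : #|Om| = #|pinf |: [set paff st | st in [set: {st | on_unital st}]]|.
  rewrite -cardsT; congr #|pred_of_set _|; apply/setP => w; rewrite in_setU1 in_setT.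
  apply/esym/orP; have [->|[st ->]] := OmegaP w; first by left.
  by right; apply: imset_f; rewrite in_setT.
rewrite cardsU1 (card_imset _ paff_inj) cardsT card_sig -card_on_unital cardsE addnC.
suff -> : pinf \notin [set paff st | st in [set: {st | on_unital st}]] by [].
apply/imsetP => -[st _ e].
by have := paff_neq_pinf st; rewrite -e eqxx.
Qed.

(** * Induced permutations and the projective groups *)

Definition induces (M : 'M[F]_3) (s : {perm Om}) :=
  forall w v, sval w = <[v]>%VS -> sval (s w) = <[(v *m M)%R]>%VS.

(** Passing from subspaces to arbitrary generators lets images be computed on a convenient
    representative. *)
Lemma induced_permsP (G : {set 'M[F]_3}) (s : {perm Om}) :
  reflect (exists2 M, M \in G & induces M s) (s \in induced_perms q G).
Proof.
rewrite inE; apply: (iffP exists_inP) => -[M GM sM]; exists M => //.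
  by move=> w v wv; move/forallP/(_ w)/eqP: sM => ->; rewrite wv limg_line lfunE.
apply/forallP => w; case/andP: (svalP w) => /eqP/dim1_vline[v _ wv] _.
by rewrite (sM _ _ wv) wv limg_line lfunE.
Qed.

Lemma induces_exists (M : 'M[F]_3) : M \in GU F q -> exists s, induces M s.
Proof.
by case/GU_induces=> s sE; exists s => w v wv; rewrite sE wv limg_line lfunE.
Qed.

Lemma induces_inj (M : 'M[F]_3) s s' : induces M s -> induces M s' -> s = s'.
Proof.
move=> sM s'M; apply/permP => w; apply: val_inj.
by case/andP: (svalP w) => /eqP/dim1_vline[v _ wv] _; rewrite /= (sM _ _ wv) (s'M _ _ wv).
Qed.

Lemma inducesM M M' s s' : induces M s -> induces M' s' ->
  induces (M *m M') (s * s')%g.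
Proof.
by move=> sM s'M w v wv; rewrite permM mulmxA (s'M _ (v *m M)) // (sM _ v).
Qed.

Lemma induces1 : induces 1%:M 1%g.
Proof. by move=> w v wv; rewrite perm1 mulmx1. Qed.

Lemma GUP (M : 'M[F]_3) : reflect
  (M \in unitmx /\ forall x y, beta q (x *m M) (y *m M) = beta q x y) (M \in GU F q).
Proof.
rewrite inE; apply: (iffP andP) => -[uM bM]; split=> //.
  by move=> x y; move/forallP/(_ x)/forallP/(_ y)/eqP: bM.
by apply/forallP => x; apply/forallP => y; rewrite bM.
Qed.

Lemma GU1 : 1%:M \in GU F q.
Proof. by apply/GUP; split=> [|x y]; rewrite ?unitmx1 ?mulmx1. Qed.

Lemma GUM M M' : M \in GU F q -> M' \in GU F q -> M *m M' \in GU F q.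
Proof.
move=> /GUP[uM bM] /GUP[uM' bM']; apply/GUP; split=> [|x y].
  by rewrite unitmx_mul uM.
by rewrite !mulmxA bM' bM.
Qed.

Lemma PGU_group_set : group_set (PGU F q).
Proof.
apply/group_setP; split=> [|s s'].
  by apply/induced_permsP; exists 1%:M; [exact: GU1 | exact: induces1].
move=> /induced_permsP[M GM sM] /induced_permsP[M' GM' sM'].
by apply/induced_permsP; exists (M *m M'); [exact: GUM | exact: inducesM].
Qed.

Lemma SU_sub_GU : SU F q \subset GU F q.
Proof. by apply/subsetP => M; rewrite [M \in SU F q]inE => /andP[]. Qed.

Lemma PSU_group_set : group_set (PSU F q).
Proof.
apply/group_setP; split=> [|s s'].
  apply/induced_permsP; exists 1%:M; last exact: induces1.
  by rewrite inE GU1 det1 eqxx.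
move=> /induced_permsP[M + sM] /induced_permsP[M' + sM'].
rewrite ![_ \in SU F q]inE => /andP[GM /eqP dM] /andP[GM' /eqP dM'].
apply/induced_permsP; exists (M *m M'); last exact: inducesM.
by rewrite inE GUM // det_mulmx dM dM' mulr1 eqxx.
Qed.

Canonical PGU_group := Group PGU_group_set.
Canonical PSU_group := Group PSU_group_set.

Lemma induced_perms_sub (G H : {set 'M[F]_3}) :
  G \subset H -> induced_perms q G \subset induced_perms q H.
Proof.
move=> /subsetP GH; apply/subsetP => s /induced_permsP[M GM sM].
by apply/induced_permsP; exists M; [apply: GH | ].
Qed.

Lemma PSU_sub_PGU : PSU F q \subset PGU F q.
Proof. exact/induced_perms_sub/SU_sub_GU. Qed.

(** * The root group acting on Omega *)

Definition root_perms : {set {perm Om}} :=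
  induced_perms q [set umx st.1 st.2 | st in [set st | on_unital st]].

Lemma root_permsP s : reflect
  (exists2 st, on_unital st & induces (umx st.1 st.2) s) (s \in root_perms).
Proof.
apply: (iffP (induced_permsP _ _)) => [[M /imsetP[st stU ->] sM]|[st stU sM]].
  by exists st => //; rewrite inE in stU.
by exists (umx st.1 st.2) => //; apply/imsetP; exists st; rewrite ?inE.
Qed.

Lemma root_perms_sub : root_perms \subset PSU F q.
Proof.
apply: induced_perms_sub; apply/subsetP => M /imsetP[[s t]]; rewrite inE => st ->.
exact: umx_SU.
Qed.

Lemma root_perms1 : 1%g \in root_perms.
Proof.
apply/root_permsP; exists (0, 0); first by rewrite /on_unital /= !qconjE mul0r !addr0.
move=> w v; rewrite perm1 /= [v]vec3_eta !mul_vec3E qconj0 oppr0 => ->.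
by congr <[vec3 _ _ _]>%VS; ring.
Qed.

Lemma root_perms_fix g : g \in root_perms -> g pinf = pinf.
Proof.
case/root_permsP=> st _ gE; apply: val_inj; rewrite /= (gE _ (vec3 1 0 0)) //.
by rewrite !mul_vec3E !(mulr0, mul0r, addr0, mulr1).
Qed.

(** Both parameters of a root element can be read off its effect on a single affine point, which
    yields transitivity and freeness. *)
Lemma mul_vec3_umx s t s' t' :
  vec3 s' t' 1 *m umx s t = vec3 (s' - t' * qconj t + s) (t' + t) 1.
Proof. by rewrite !mul_vec3E; congr vec3; ring. Qed.

Lemma root_perms_trans b c : b != pinf -> c != pinf ->
  exists2 g, g \in root_perms & g b = c.
Proof.
have [->|[[[s1 t1] st1] ->]] := OmegaP b; first by rewrite eqxx.
have [->|[[[s2 t2] st2] ->]] := OmegaP c; first by rewrite eqxx.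
move=> _ _; set t := t2 - t1; set s := s2 - s1 + t1 * qconj t.
have st : on_unital (s, t).
  move: st1 st2; rewrite /on_unital /= !qconjE => /eqP st1 /eqP st2; apply/eqP.
  (* The unital equation for the parameters is the difference of those for the two points. *)
  transitivity ((s2 + qconj s2 + t2 * qconj t2) - (s1 + qconj s1 + t1 * qconj t1)).
    by rewrite /s /t !qconjE; ring.
  by rewrite st1 st2 subrr.
have [g gE] := induces_exists (subsetP SU_sub_GU _ (umx_SU st)).
exists g; first by apply/root_permsP; exists (s, t).
apply: val_inj; rewrite /= (gE _ (vec3 s1 t1 1)) //= mul_vec3_umx.
by congr <[vec3 _ _ _]>%VS; rewrite /s /t; ring.
Qed.

Lemma root_perms_free b g h : b != pinf -> g \in root_perms -> h \in root_perms ->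
  g b = h b -> g = h.
Proof.
have [->|[[[s1 t1] st1] ->]] := OmegaP b; first by rewrite eqxx.
move=> _ /root_permsP[[s t] _ gE] /root_permsP[[s' t'] _ hE] /(congr1 val) /=.
rewrite (gE _ (vec3 s1 t1 1)) // (hE _ (vec3 s1 t1 1)) //= !mul_vec3_umx.
case/vline_eqP; first by rewrite vec3_eq0 oner_eq0 !andbF.
move=> k _; rewrite scale_vec3 => /vec3_inj[e1 e2]; rewrite mulr1 => k1.
move: e1 e2; rewrite -k1 !mul1r => e1 /addrI e2.
by move: e1; rewrite e2 => /addrI e1; move: hE; rewrite /= -e1 -e2; apply: induces_inj.
Qed.

Lemma zero_on_unital : on_unital (0, 0).
Proof. by rewrite /on_unital /= !qconjE mul0r !addr0. Qed.

Definition porig : Om := paff (exist on_unital _ zero_on_unital).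

Lemma PSU_moves : exists2 s, s \in PSU F q & s pinf != pinf.
Proof.
have [s sE] := induces_exists (subsetP SU_sub_GU _ wmx_SU).
exists s; first by apply/induced_permsP; exists wmx => //; apply: wmx_SU.
have -> : s pinf = porig; last exact: paff_neq_pinf.
apply: val_inj; rewrite /= (sE _ (vec3 1 0 0)) //.
by rewrite !mul_vec3E !(mulr0, mul0r, addr0, mulr1).
Qed.

Lemma Omega_gt1 : (1 < #|Om|)%N.
Proof. by rewrite card_Omega addn1 ltnS expn_gt0 (ltnW q_gt1). Qed.

(** * The Frobenius map: its fixed points and its agreement with PGU(3,q) *)

Local Notation frob := (frob_perm q pcharF).

Lemma frob_pinf : frob pinf = pinf.
Proof.
apply: val_inj; rewrite /= (frob_permE pcharF (v := vec3 1 0 0)) // pow_vec3.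
by rewrite expr1n expr0n (gtn_eqF (prime_gt0 p_pr)).
Qed.

Lemma frob_paff st : sval (frob (paff st)) =
  <[vec3 ((sval st).1 ^+ p) ((sval st).2 ^+ p) 1]>%VS.
Proof. by rewrite (frob_permE pcharF (v := vec3 (sval st).1 (sval st).2 1)) // pow_vec3 expr1n. Qed.

Lemma frob_porig : frob porig = porig.
Proof.
by apply: val_inj; rewrite [LHS]frob_paff /= expr0n (gtn_eqF (prime_gt0 p_pr)).
Qed.

(** Over the prime field [qconj] is trivial and the unital equation reads 2 s + t^2 = 0. For odd [p]
    it determines s from t; for [p = 2] it forces t = 0 and leaves s free. *)
Definition frob_fixed_coords (k : nat) : F * F :=
  if p == 2 then (k%:R, 0) else (- (k%:R ^+ 2 / 2), k%:R).

Lemma frob_fixed_coordsP k : let st := frob_fixed_coords k in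
  [/\ on_unital st, st.1 ^+ p = st.1 & st.2 ^+ p = st.2].
Proof.
have kp : (k%:R : F) ^+ p = k%:R by rewrite -(pFrobenius_autE pcharF) rmorph_nat.
rewrite /= /frob_fixed_coords; case: eqP => [p2|np2]; rewrite /on_unital /=.
  rewrite (qconj_prime_field kp) qconj0 mul0r addr0; split=> //; last first.
    by rewrite expr0n (gtn_eqF (prime_gt0 p_pr)).
  by have := pcharF; rewrite p2 => c2; rewrite addrr_pchar2.
have n2 : (2 : F) != 0.
  rewrite -(dvdn_pcharf pcharF) dvdn_prime2 //; exact/eqP.
have sp : (- (k%:R ^+ 2 / 2) : F) ^+ p = - (k%:R ^+ 2 / 2).
  by rewrite -(pFrobenius_autE pcharF) rmorphN fmorph_div rmorphXn /= !rmorph_nat.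
by rewrite (qconj_prime_field kp) (qconj_prime_field sp); split=> //; apply/eqP; field.
Qed.

Lemma frob_fixed_on_unital k : on_unital (frob_fixed_coords k).
Proof. by case: (frob_fixed_coordsP k). Qed.

Lemma frob_fixed_coords_inj (i j : 'I_p) :
  frob_fixed_coords i = frob_fixed_coords j -> i = j.
Proof.
have natr_inj (m n : nat) : (m <= n)%N -> (n < p)%N -> m%:R = n%:R :> F -> m = n.
  move=> mn np e; apply/eqP; rewrite eqn_leq mn /= -subn_eq0.
  have : (p %| n - m)%N by rewrite (dvdn_pcharf pcharF) natrB // e subrr.
  by case: (n - m)%N (leq_ltn_trans (leq_subr m n) np) => // d dp /dvdn_leq; lia.
move=> e; have {}e : (i%:R : F) = j%:R.
  by move: e; rewrite /frob_fixed_coords; case: (p == 2) => -[].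
apply: val_inj; have [ij|/ltnW ij] := leqP i j; first exact: natr_inj e.
by apply/esym; apply: natr_inj (esym e).
Qed.

Lemma card_frob_fixed : (p + 1 <= #|agreement frob 1|)%N.
Proof.
pose P (i : 'I_p) := paff (exist on_unital _ (frob_fixed_on_unital i)).
have Pinj : injective P.
  by move=> i j /paff_inj /(congr1 val) /=; apply: frob_fixed_coords_inj.
pose A : {set Om} := pinf |: [set P i | i in [set: 'I_p]].
have cardA : #|A| = (p + 1)%N.
  rewrite cardsU1 card_imset // cardsT card_ord addnC.
  suff -> : pinf \notin [set P i | i in [set: 'I_p]] by [].
  by apply/imsetP => -[i _ /esym/eqP]; apply/negP/paff_neq_pinf.
rewrite -cardA; apply: subset_leq_card; apply/subsetP => w.
case/setU1P=> [->|/imsetP[i _ ->]]; first by rewrite in_agreement perm1 frob_pinf.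
rewrite in_agreement perm1; apply/eqP/val_inj; rewrite [RHS]frob_paff /=.
by case: (frob_fixed_coordsP i) => _ -> ->.
Qed.

(* If some solution has t != 0, then s / (t qconj t) lies in the prime field for
   every solution, so s = qconj s and 2 s = - t qconj t is determined by t; otherwise
   t = 0 throughout. *)
Lemma card_diagonal_solutions (al ga : F) : ga * qconj ga = al ->
  (#|[set st : F * F | [&& on_unital st, st.1 ^+ p == al * st.1
                        & st.2 ^+ p == ga * st.2]]%R| <= p)%N.
Proof.
move=> gaE; set S := [set st | _].
(* A coordinate that is injective on [S] takes its values among the at most [p] roots of x^p = k
   x. *)
have Sinj (h : F * F -> F) (k : F) : {in S &, injective h} ->
    (forall st, st \in S -> h st ^+ p = k * h st) -> (#|S| <= p)%N.
  move=> hinj hS; rewrite -(card_in_imset hinj).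
  rewrite (leq_trans _ (card_trinomial_roots (- k) 0 (prime_gt1 p_pr))) //.
  apply: subset_leq_card; apply/subsetP => _ /imsetP[st stS ->].
  by rewrite inE hS // mulNr subrr.
have SP st : st \in S -> [/\ st.1 + qconj st.1 = - (st.2 * qconj st.2),
    st.1 ^+ p = al * st.1 & st.2 ^+ p = ga * st.2].
  by rewrite inE => /and3P[/eqP/(canRL (addrK _)) + /eqP-> /eqP->]; rewrite add0r.
case: (boolP [exists st in S, st.2 != 0]) => [/exists_inP[[s0 t0] S0 /= nt0]|]; last first.
  rewrite negb_exists_in => /forall_inP S0.
  apply: (Sinj fst al) => [[s t] [s' t'] /= st st' ss'|st /SP[]//].
  move: (S0 _ st) (S0 _ st'); rewrite /= !negbK ss' => /eqP-> /eqP->.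
  by [].
have [/= e0 s0p t0p] := SP _ S0.
set n := t0 * qconj t0 in e0; have nn : n != 0 by rewrite mulf_neq0 ?qconj_eq0.
have nc : qconj n = n by rewrite /n !qconjE mulrC.
(* The norm of [t0] satisfies the same equation x^p = al x as s, so their quotient is fixed by the
   Frobenius automorphism. *)
have np : n ^+ p = al * n.
  have cp : qconj t0 ^+ p = qconj (t0 ^+ p) by rewrite /qconj exprAC.
  by rewrite /n exprMn cp t0p qconjM -gaE; ring.
have s_real s : s ^+ p = al * s -> qconj s = s.
  move=> sp; have rp : (s / n) ^+ p = s / n.
    have na : al != 0.
      by apply: contraNneq nn => a0; have := np; rewrite a0 mul0r => /eqP; rewrite expf_eq0 => /andP[_ /eqP->].
    by rewrite expr_div_n sp np -mulf_div divff // mul1r.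
  by have := qconj_prime_field rp => r; rewrite -(divfK nn s) qconjM r nc.
(* In characteristic 2 the real [s0] would have trace 0, whereas its trace is [- n]. *)
have n2 : (2 : F) != 0.
  apply: contraNneq nn => c2; have := e0; rewrite s_real // -mulr2n -mulr_natr c2 mulr0.
  by move/eqP; rewrite eq_sym oppr_eq0.
apply: (Sinj snd ga) => [[s t] [s' t'] /= /SP[/= e sp _] /SP[/= e' sp' _] tt'|st /SP[]//].
rewrite tt'; congr (_, _); apply: (mulIf n2); rewrite !mulr_natr !mulr2n.
by rewrite -{2}(s_real _ sp) -{2}(s_real _ sp') e e' tt'.
Qed.

(** An isometry fixing <(1,0,0)> and <(0,0,1)> also fixes <(0,1,0)>, the orthogonal complement of
    their span; the norm conditions come from pairing images of basis vectors. *)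
Lemma GU_diagonal (M : 'M[F]_3) a c : M \in GU F q ->
  vec3 1 0 0 *m M = vec3 a 0 0 -> vec3 0 0 1 *m M = vec3 0 0 c ->
  exists b, [/\ c * qconj a = 1, b * qconj b = 1
    & forall s t, vec3 s t 1 *m M = vec3 (a * s) (b * t) c].
Proof.
case/GUP=> _ bM e1 e3.
have [x [b [y e2]]] : exists x b y, vec3 0 1 0 *m M = vec3 x b y.
  by exists ((vec3 0 1 0 *m M) 0 0), ((vec3 0 1 0 *m M) 0 1), ((vec3 0 1 0 *m M) 0 2);
     rewrite -vec3_eta.
have := bM (vec3 0 0 1) (vec3 1 0 0).
rewrite e1 e3 !betaE !qconjE !(mul0r, mulr0, add0r, mulr1) => ca.
have := bM (vec3 0 1 0) (vec3 1 0 0).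
rewrite e1 e2 !betaE !qconjE !(mul0r, mulr0, add0r, mulr1) => /eqP.
rewrite mulf_eq0 => /orP[/eqP y0|/eqP a0]; last first.
  by move/eqP: ca; rewrite a0 mulr0 eq_sym oner_eq0.
have := bM (vec3 0 1 0) (vec3 0 0 1).
rewrite e3 e2 !betaE !qconjE !(mul0r, mulr0, add0r, addr0, mulr1) => /eqP.
rewrite mulf_eq0 qconj_eq0 => /orP[/eqP x0|/eqP c0]; last first.
  by move/eqP: ca; rewrite c0 mul0r eq_sym oner_eq0.
have := bM (vec3 0 1 0) (vec3 0 1 0).
rewrite e2 x0 y0 !betaE !qconjE !(mul0r, mulr0, add0r, addr0, mulr1) => bb.
exists b; split=> // s t.
have -> : vec3 s t 1 = s *: vec3 1 0 0 + t *: vec3 0 1 0 + vec3 0 0 1.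
  by rewrite !scale_vec3 !add_vec3 !(mulr0, mulr1, addr0, add0r).
rewrite !mulmxDl -!scalemxAl e1 e2 e3 x0 y0 !scale_vec3 !add_vec3.
by rewrite !(mulr0, addr0, add0r) !(mulrC s, mulrC t).
Qed.

Lemma agreement_frob_diagonal g : g \in PGU F q -> g pinf = pinf -> g porig = porig ->
  (#|agreement frob g| <= p + 1)%N.
Proof.
case/induced_permsP=> M GM gM ginf gorig.
have [a e1] : exists a, vec3 1 0 0 *m M = vec3 a 0 0.
  have /vlineP[a ->] : vec3 1 0 0 *m M \in <[vec3 1 0 0]>%VS.
    have /= <- := congr1 val ginf.
    by rewrite (gM _ (vec3 1 0 0)) // memv_line.
  by exists a; rewrite scale_vec3 mulr1 mulr0.
have [c e3] : exists c, vec3 0 0 1 *m M = vec3 0 0 c.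
  have /vlineP[c ->] : vec3 0 0 1 *m M \in <[vec3 0 0 1]>%VS.
    have /= <- := congr1 val gorig.
    by rewrite (gM _ (vec3 0 0 1)) // memv_line.
  by exists c; rewrite scale_vec3 mulr1 mulr0.
have [b [ca bb eM]] := GU_diagonal GM e1 e3.
have nc : c != 0 by apply: contra_eq_neq ca => ->; rewrite mul0r eq_sym oner_eq0.
have cV : c^-1 = qconj a by apply: (mulfI nc); rewrite divff // ca.
(* As 1/c is [qconj a], the ratios a/c and b/c are [a * qconj a] and [b * qconj a]; this is the norm
   relation asked for by [card_diagonal_solutions]. *)
have gaE : b * qconj a * qconj (b * qconj a) = a * qconj a.
  rewrite !qconjE; transitivity ((b * qconj b) * (a * qconj a)); first by ring.
  by rewrite bb mul1r.
have cardS := card_diagonal_solutions gaE.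
rewrite -(leq_add2r 1) in cardS; apply: leq_trans cardS.
set S := [set st | _].
(* The point [pinf] accounts for the 1 added to the number of affine solutions. *)
pose A : {set Om} := pinf |: [set paff st | st in [set st | sval st \in S]].
have subA : agreement frob g \subset A.
  apply/subsetP => w wA; have /eqP gw : g w == frob w by rewrite -in_agreement.
  apply/setU1P.
  have [->|[st wE]] := OmegaP w; first by left.
  right; rewrite wE; apply: imset_f; rewrite !inE (svalP st) /=.
  move/(congr1 val): gw; rewrite wE /= frob_paff (gM _ (vec3 (sval st).1 (sval st).2 1)) //.
  rewrite eM => /esym/vline_eqP[|k _]; first by rewrite vec3_eq0 oner_eq0 !andbF.
  rewrite scale_vec3 => /vec3_inj[-> -> kc].
  have -> : k = qconj a by rewrite -cV; apply: (mulIf nc); rewrite mulVf // kc.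
  by rewrite !mulrA !(mulrC (qconj a)) !eqxx.
apply: leq_trans (subset_leq_card subA) _.
rewrite cardsU1 addnC leq_add ?leq_b1 //.
rewrite (leq_trans (leq_imset_card _ _)) // -(card_imset _ val_inj).
by apply: subset_leq_card; apply/subsetP => _ /imsetP[st + ->]; rewrite inE.
Qed.

(** Conjugation by the semilinear map applies the Frobenius automorphism to the matrix entries. *)
Lemma frob_normalizes_PGU k : k \in PGU F q ->
  exists2 k', k' \in PGU F q & (k * frob = frob * k')%g.
Proof.
case/induced_permsP=> K GK kK; pose K' := map_mx (pFrobenius_aut pcharF) K.
have powM x : pow_coords p (x *m K) = pow_coords p x *m K'.
  by rewrite /pow_coords (map_mxM (pFrobenius_aut pcharF)).
(* Every vector is a value of [pow_coords], so the isometry property of [K'] follows from that of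
   [K] by taking p-th powers of the form. *)
have [powV _ powVK] := injF_bij (pow_coords_inj pcharF (F := F)).
have GK' : K' \in GU F q.
  case/GUP: GK => uK bK; apply/GUP; split=> [|x y]; first by rewrite map_unitmx.
  by rewrite -(powVK x) -(powVK y) -!powM !(beta_pow_coords _ pcharF) bK.
have [k' k'K] := induces_exists GK'.
exists k'; first by apply/induced_permsP; exists K'.
apply/permP => w; apply: val_inj; rewrite !permM.
case/andP: (svalP w) => /eqP/dim1_vline[v _ wv] _.
have kw := kK _ _ wv; rewrite /= (frob_permE pcharF kw) powM.
by rewrite (k'K _ _ (frob_permE pcharF wv)).
Qed.

Lemma agreement_frob_PGU g : g \in PGU F q -> (#|agreement frob g| <= p + 1)%N.
Proof.
move=> Gg; rewrite leqNgt; apply/negP => gt_p.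
have /card_gt1P[w1 [w2 [+ + nw]]] : (1 < #|agreement frob g|)%N.
  by rewrite (leq_trans _ gt_p) // addn1.
rewrite !in_agreement => /eqP gw1 /eqP gw2.
(* Two points of agreement are moved to [pinf] and [porig]; then [k * g * k'^-1] fixes both and
   agrees with [frob] in equally many points as [g]. *)
have [k [Gk k1 k2]] := @two_transitive_of_regular _ [group of PSU F q] root_perms pinf
  root_perms_sub root_perms_fix root_perms_trans PSU_moves w1 w2 porig
  (paff_neq_pinf _) nw.
have {}Gk := subsetP PSU_sub_PGU _ Gk.
have [k' Gk' kk'] := frob_normalizes_PGU Gk.
have kE w : frob (k w) = k' (frob w) by rewrite -!permM kk'.
move: gt_p; apply/negP; rewrite -leqNgt -(agreement_moved _ k) kk'.
rewrite -(agreement_mulr _ _ k'^-1%g) mulgK; apply: agreement_frob_diagonal.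
- by rewrite !(groupM (G := [group of PGU F q])) // (groupVr (G := [group of PGU F q])).
- by rewrite !permM k1 gw1 -k1 kE permK frob_pinf.
- by rewrite !permM k2 gw2 -k2 kE permK frob_porig.
Qed.

Lemma PSU_agreement_ge2 v : exists2 g, g \in PSU F q & (2 <= #|agreement v g|)%N.
Proof.
exact: (@exists_agreement_ge2 _ [group of PSU F q] _ _ root_perms_sub
  root_perms_fix root_perms_trans PSU_moves v Omega_gt1).
Qed.

Lemma PSU_agreement_ge3 v : ~~ odd q ->
  exists2 g, g \in PSU F q & (3 <= #|agreement v g|)%N.
Proof.
move=> evenq; have oddT : odd #|Om| by rewrite card_Omega addn1 /= oddX.
exact: (@exists_agreement_ge3 _ [group of PSU F q] _ _ root_perms_sub root_perms1
  root_perms_fix root_perms_trans root_perms_free PSU_moves v Omega_gt1 oddT).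
Qed.

End Unital.

Theorem theorem1p2 (p f q : nat) (F : finFieldType) (p_pr : prime p)
    (f_gt0 : 0 < f) (q_def : q = p ^ f) (card_F : #|F| = q ^ 2) :
  #|Omega F q| = q ^ 3 + 1
  /\ (q ^ 3 - p <= covering_radius (PGU F q)
      /\ covering_radius (PGU F q) <= covering_radius (PSU F q)
      /\ covering_radius (PSU F q) <= q ^ 3 - gcdn 2 q)
  /\ (~~ odd q ->
        covering_radius (PGU F q) = q ^ 3 - 2
        /\ covering_radius (PSU F q) = q ^ 3 - 2)
  /\ hamming_to (frob_perm q (pchar_of_card p_pr q_def card_F)) (PGU F q)
     = q ^ 3 - p.
Proof.
have cardO := card_Omega p_pr f_gt0 q_def card_F.
set h := frob_perm _ _.
have dist_h : hamming_to h (PGU F q) = q ^ 3 - p.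
  (* Omega has q^3 + 1 points, so distance q^3 - p means agreement in p + 1 points; the identity
     attains this. *)
  have -> : q ^ 3 - p = #|Omega F q| - (p + 1) by rewrite cardO subnDr.
  apply/eqP; rewrite eqn_leq; apply/andP; split.
    apply: hamming_to_leq_agreement (card_frob_fixed p_pr f_gt0 q_def card_F).
    exact: (group1 (PGU_group q F)).
  apply: leq_hamming_to (leq_subr _ _) _ => g Gg.
  by rewrite hammingE leq_sub2l // (agreement_frob_PGU p_pr f_gt0 q_def card_F).
have lower : q ^ 3 - p <= covering_radius (PGU F q).
  by rewrite -dist_h leq_covering_radius.
have middle : covering_radius (PGU F q) <= covering_radius (PSU F q).
  exact/covering_radius_subset/PSU_sub_PGU.
have upper : covering_radius (PSU F q) <= q ^ 3 - gcdn 2 q.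
  apply/covering_radius_leP => v.
  have -> : q ^ 3 - gcdn 2 q = #|Omega F q| - (gcdn 2 q + 1) by rewrite cardO subnDr.
  (* Agreement in 2 points is enough for odd q, where the gcd is 1; for even q the gcd is 2 and a
     third point is needed. *)
  case: (boolP (odd q)) => [oddq|evenq].
    have -> : gcdn 2 q = 1 by apply/eqP; rewrite -[_ == _]/(coprime 2 q) coprime2n.
    have [g Gg g2] := PSU_agreement_ge2 p_pr f_gt0 q_def card_F v.
    exact: hamming_to_leq_agreement Gg g2.
  have -> : gcdn 2 q = 2 by apply/gcdn_idPl; rewrite dvdn2.
  have [g Gg g3] := PSU_agreement_ge3 p_pr f_gt0 q_def card_F v evenq.
  exact: hamming_to_leq_agreement Gg g3.
split=> //; split; first by split.
split=> // evenq.
(* For even q the lower bound q^3 - p becomes q^3 - 2 and meets the upper bound. *)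
have p2 : p = 2.
  have : 2 %| p ^ f by rewrite -q_def dvdn2.
  by rewrite Euclid_dvdX // f_gt0 andbT dvdn_prime2 // => /eqP.
have g2 : gcdn 2 q = 2 by apply/gcdn_idPl; rewrite dvdn2.
rewrite p2 in lower; rewrite g2 in upper.
by split; apply/eqP; rewrite eqn_leq ?upper ?lower ?(leq_trans middle) ?(leq_trans lower).
Qed.
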